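(* Let $P$ be a finite bounded poset with a quasi-$CL$-labeling $\lambda$. Then the face poset of $\vert P\vert$ has an acyclic (discrete Morse) matching such that, for each unmatched (critical) face $\sigma$, if $\mathbf c$ is the first maximal chain (in the lexicographic order) containing $\sigma$, then $\mathbf c$ is weakly descending, and $\dim\sigma\geq\ell_0(\mathbf c)+\ell_1(\mathbf c)-2$, where $\ell_0(\mathbf c)$ is the number of distinct labels and $\ell_1(\mathbf c)$ the number of repeated labels on $\mathbf c$.
   Context: $\vert P\vert$ is the simplicial complex of chains of $P\setminus\{\hat0,\hat1\}$. A chain-edge labeling assigns labels from a totally ordered set to cover relations $u\lessdot v$ with a root (maximal chain of $[\hat0,u]$); a maximal chain's labels are taken with roots along it; a label is repeated on $\mathbf c$ if it occurs on at least two cover relations of $\mathbf c$; weakly descending (ascending) means weakly decreasing (increasing) label sequence. For an interval $[x,y]$ with root $\mathbf r$, maximal chains of $[x,y]$ are compared lexicographically by label sequences (each cover rooted by $\mathbf r$ followed by the chain below). A quasi-$CL$-labeling: for every interval $[x,y]$ and root $\mathbf r$ there is a chain $\mathbf a=\{x=a_0<\dots<a_k=y\}$ such that (i) every weakly ascending maximal chain of $[x,y]$ contains $\mathbf a$; (ii) for each $i$ all cover relations $u\lessdot v$ with $a_{i-1}\le u\lessdot v\le a_i$ receive a common label (rooted by $\mathbf r$ followed by a maximal chain of $[x,u]$ through $a_0,\dots,a_{i-1}$); (iii) maximal chains containing $\mathbf a$ are strictly lexicographically earlier than those not containing $\mathbf a$. The maximal chains of $P$ are totally ordered lexicographically by label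 sequences, with ties broken consistently (e.g. via a fixed linear extension of $P$). An acyclic matching is a matching of faces $\sigma\subset\tau$ with $\dim\tau=\dim\sigma+1$ in the face poset, whose associated modified Hasse diagram has no directed cycles; by discrete Morse theory $\vert P\vert$ is then homotopy equivalent to a CW complex with one cell of dimension $\dim\sigma$ for each unmatched face $\sigma$.
   Formalization: A quasi-CL-labeling is also required to have a weakly ascending maximal chain in every rooted interval (else false); the empty face belongs to the face poset; maximal chains are compared at their first divergence, by label, then by the linear extension. *)

(* Defs.v *)
From HB Require Import structures.
From mathcomp Require Import all_boot all_order all_algebra.

Set Implicit Arguments.
Unset Strict Implicit.
Unset Printing Implicit Defensive.

Import Order.TTheory GRing.Theory Num.Theory.

Local Open Scope order_scope.

Section Poset.

Context {d : Order.disp_t} {P : finTBPOrderType d}.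

Definition cover (x y : P) : bool :=
  (x < y) && [forall z, ~~ ((x < z) && (z < y))].

(* A chain with least element x is encoded by x together with the sequence
   of its other elements, listed from bottom to top; its full element list
   is x :: s. In particular a root of u, i.e. a maximal chain of [\bot, u],
   is encoded by the sequence of its elements above \bot. *)
Definition maxchain (x y : P) (s : seq P) : bool :=
  path cover x s && (last x s == y).

(* The order complex of P minus {\bot, \top}. The empty face, of dimension
   -1, is a face; this is the convention for which acyclic matchings may
   match a vertex with the empty face. *)
Definition is_face (sigma : {set P}) : bool :=
  [forall x in sigma, (x != \bot) && (x != \top)] &&
  [forall x in sigma, forall y in sigma, x >=< y].

Definition face_dim (sigma : {set P}) : int := (#|sigma|%:Z - 1)%R.

Definition face_cover (sigma tau : {set P}) : bool :=
  [&& is_face sigma, is_face tau, sigma \subset tau & #|tau| == #|sigma|.+1].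

Definition is_matching (M : {set {set P} * {set P}}) : Prop :=
  (forall p, p \in M -> face_cover p.1 p.2) /\
  (forall p q, p \in M -> q \in M ->
     [|| p.1 == q.1, p.1 == q.2, p.2 == q.1 | p.2 == q.2] -> p = q).

(* The arrows of the Hasse diagram of the face poset point down, except
   that those of the matched pairs are reversed. *)
Definition modified_hasse (M : {set {set P} * {set P}}) : rel {set P} :=
  [rel f g | (face_cover g f && ((g, f) \notin M)) || ((f, g) \in M)].

Definition acyclic_matching (M : {set {set P} * {set P}}) : Prop :=
  is_matching M /\
  (forall s : seq {set P}, cycle (modified_hasse M) s -> s = [::]).

Definition critical (M : {set {set P} * {set P}}) (sigma : {set P}) : Prop :=
  is_face sigma /\
  (forall p, p \in M -> p.1 <> sigma /\ p.2 <> sigma).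

Definition linear_extension (ext : rel P) : Prop :=
  [/\ reflexive ext, antisymmetric ext, transitive ext, total ext
    & forall x y : P, x <= y -> ext x y].

Section Labeling.

Context {d' : Order.disp_t} {L : orderType d'}.

(* A chain-edge labeling is a function lam : seq P -> P -> P -> L, where
   lam r u v is the label of the cover relation from u to v with root r.
   Only the values with maxchain \bot u r and cover u v are ever used. *)
Implicit Type lam : seq P -> P -> P -> L.

Fixpoint labels lam (r : seq P) (x : P) (s : seq P) : seq L :=
  if s is y :: s' then lam r x y :: labels lam (rcons r y) y s' else [::].

Definition weakly_ascending (l : seq L) : bool := sorted <=%O l.
Definition weakly_descending (l : seq L) : bool := sorted >=%O l.

(* A proper prefix comes before the longer sequence. *)
Definition lex_lt (l1 l2 : seq L) : bool :=
  @Order.lt _ (seqlexi L) l1 l2.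

(* The chain a_0 < ... < a_k is x :: a. The existence of a weakly ascending
   maximal chain is a required part of the definition, as for CL-labelings;
   given the other clauses, it says that the weakly ascending maximal chains
   are exactly those containing a. *)
Definition quasi_chain lam (r : seq P) (x y : P) (a : seq P) : Prop :=
  [/\ path <%O x a /\ last x a = y,
      exists2 s, maxchain x y s & weakly_ascending (labels lam r x s),
      forall s, maxchain x y s -> weakly_ascending (labels lam r x s) ->
        {subset x :: a <= x :: s},
      forall i, (i < size a)%N -> exists l : L, forall u v t,
        nth x (x :: a) i <= u -> cover u v -> v <= nth x (x :: a) i.+1 ->
        maxchain x u t -> {subset take i.+1 (x :: a) <= x :: t} ->
        lam (r ++ t) u v = l
    & forall s t, maxchain x y s -> maxchain x y t ->
        {subset x :: a <= x :: s} -> ~ {subset x :: a <= x :: t} ->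
        lex_lt (labels lam r x s) (labels lam r x t)].

Definition quasi_CL_labeling lam : Prop :=
  forall (x y : P) (r : seq P), x <= y -> maxchain \bot x r ->
    exists a : seq P, quasi_chain lam r x y a.

(* The lexicographic order on maximal chains, ties being broken consistently:
   two chains are compared at the first place where they diverge, by the
   labels there, and if these labels are equal by the linear extension ext.
   Thus the comparison only depends on the two chains up to their first
   divergence. Breaking ties only between chains with equal full label
   sequences would not have this property, as the labels above the divergence
   depend on the root. *)
Fixpoint chain_lt lam (ext : rel P) (r : seq P) (x : P) (s t : seq P) : bool :=
  match s, t with
  | y :: s', z :: t' =>
      if y == z then chain_lt lam ext (rcons r y) y s' t'
      else (lam r x y < lam r x z) || ((lam r x y == lam r x z) && ext y z)
  | _, _ => false
  end.

Definition first_maxchain lam (ext : rel P) (sigma : {set P}) (c : seq P) :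
    Prop :=
  [/\ maxchain \bot \top c,
      {subset sigma <= \bot :: c}
    & forall c', maxchain \bot \top c' -> {subset sigma <= \bot :: c'} ->
        c' <> c -> chain_lt lam ext [::] \bot c c'].

End Labeling.

End Poset.

Definition num_labels {d : Order.disp_t} {L : orderType d} (l : seq L) : nat :=
  size (undup l).

Definition num_repeated {d : Order.disp_t} {L : orderType d} (l : seq L) :
    nat :=
  size [seq a <- undup l | (2 <= count_mem a l)%N].

(* Main.v *)
(** Order the maximal chains lexicographically and sort the faces by the first
chain containing them.  Within the class of a chain c, match by toggling an
element b of c whose removal never leaves the class; if there is no such b,
match nothing.  First chains decrease weakly along the modified Hasse diagram
and toggling one fixed element is acyclic, so the matching is acyclic.

A subset of c which already lies in an earlier chain misses all elements of c
strictly inside some interval [w, v] that an earlier chain bypasses.  In a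
quasi-CL-labeling the weakly ascending chains of an interval are exactly those
containing the quasi-chain a.  Hence, if c is not weakly ascending on [w, v],
it has a strict descent there, and the descent alone can be bypassed; if it is
weakly ascending, then the bypass can be rerouted through the first element of
a above w, and c has constant labels up to that element.  Consequently, if c
admits no toggle, every inner element of c is a strict descent or lies in a
bypassed interval with constant labels.  So c is weakly descending, and a face
of its class contains all strict descents and, for each repeated label, a
further element with that label on both sides. *)

From mathcomp Require Import all_boot all_order all_algebra.
From mathcomp Require Import zify.
Require Import Defs.

Set Implicit Arguments.
Unset Strict Implicit.
Unset Printing Implicit Defensive.

Import Order.TTheory.

Local Open Scope order_scope.

(** * Maximal chains of intervals *)

Section MaximalChains.

Context {d : Order.disp_t} {P : finTBPOrderType d}.
Implicit Types (x y z u v : P) (s t : seq P).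

Lemma cover_lt x y : cover x y -> x < y.
Proof. by case/andP. Qed.

Lemma cover_no_between x y z : cover x y -> x < z -> z < y -> False.
Proof.
by case/andP => _ /forallP/(_ z) /negP nb xz zy; apply: nb; rewrite xz zy.
Qed.

Lemma path_cover_lt x s : path cover x s -> path <%O x s.
Proof. exact: (sub_path cover_lt). Qed.

Lemma maxchain_cat x y s t :
  maxchain x y (s ++ t) = maxchain x (last x s) s && maxchain (last x s) y t.
Proof. by rewrite /maxchain cat_path last_cat eqxx andbT andbA. Qed.

Lemma maxchain_cons x y z s :
  maxchain x y (z :: s) = cover x z && maxchain z y s.
Proof. by rewrite /maxchain /= andbA. Qed.

Lemma maxchain_last x y s : maxchain x y s -> last x s = y.
Proof. by case/andP => _ /eqP. Qed.

Lemma maxchain_path_lt x y s : maxchain x y s -> path <%O x s.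
Proof. by case/andP => /path_cover_lt. Qed.

Lemma maxchain_uniq x y s : maxchain x y s -> uniq (x :: s).
Proof.
by move/maxchain_path_lt => ps; apply: (@lt_sorted_uniq _ _ (x :: s)).
Qed.

Lemma maxchain_le x y s : maxchain x y s -> x <= y.
Proof.
elim: s x => [|z s IH] x; first by move/maxchain_last => /= ->.
rewrite maxchain_cons => /andP[/cover_lt xz /IH].
exact: le_trans (ltW xz).
Qed.

Lemma maxchain_neq x y s : maxchain x y s -> x != y -> s <> [::].
Proof. by case: s => // /maxchain_last /= ->; rewrite eqxx. Qed.

Lemma maxchain_refl x s : maxchain x x s -> s = [::].
Proof.
case: s => // z s; rewrite maxchain_cons => /andP[/cover_lt xz /maxchain_le zx].
by move: (lt_le_trans xz zx); rewrite ltxx.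
Qed.

Lemma maxchain_cover x y s : cover x y -> maxchain x y s -> s = [:: y].
Proof.
move=> cxy; case: s => [/maxchain_last /= e|z s].
  by move: (cover_lt cxy); rewrite e ltxx.
rewrite maxchain_cons => /andP[cxz mzy].
have [e|zy] := eqVneq z y; first by move: mzy; rewrite e => /maxchain_refl ->.
have zlt : z < y by rewrite lt_neqAle zy (maxchain_le mzy).
by case: (cover_no_between cxy (cover_lt cxz) zlt).
Qed.

Lemma maxchain_split x y z s : maxchain x y s -> z \in x :: s ->
  exists s1 s2, [/\ s = s1 ++ s2, maxchain x z s1 & maxchain z y s2].
Proof.
move=> ms; rewrite inE => /orP[/eqP -> | /splitPr zs].
  by exists [::], s; split=> //; rewrite /maxchain /= eqxx.
case: zs ms => s1 s2; rewrite -cat_rcons maxchain_cat last_rcons => /andP[m1 m2].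
by exists (rcons s1 z), s2.
Qed.

Lemma maxchain_mem_le x y z s : maxchain x y s -> z \in x :: s -> x <= z <= y.
Proof.
by move=> ms /(maxchain_split ms)[s1 [s2 [_ /maxchain_le -> /maxchain_le ->]]].
Qed.

Lemma maxchain_last_mem x y s : maxchain x y s -> y \in x :: s.
Proof. by move/maxchain_last <-; rewrite mem_last. Qed.

Lemma maxchain_comparable x y s u v :
  maxchain x y s -> u \in x :: s -> v \in x :: s -> u >=< v.
Proof.
move=> ms us; case: (maxchain_split ms us) => s1 [s2 [-> m1 m2]].
rewrite -cat_cons mem_cat => /orP[vs|vs].
  by case/andP: (maxchain_mem_le m1 vs) => _; apply: ge_comparable.
have vs' : v \in u :: s2 by rewrite inE vs orbT.
by case/andP: (maxchain_mem_le m2 vs') => + _; apply: le_comparable.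
Qed.

(** * Label sequences and the chains containing a quasi-chain *)

Section Labels.

Context {d' : Order.disp_t} {L : orderType d'}.
Variable lam : seq P -> P -> P -> L.
Implicit Types (r a c : seq P) (l : L).

Lemma size_labels r x s : size (labels lam r x s) = size s.
Proof. by elim: s r x => //= y s IH r x; rewrite IH. Qed.

Lemma labels_cat r x s t :
  labels lam r x (s ++ t) =
    labels lam r x s ++ labels lam (r ++ s) (last x s) t.
Proof.
elim: s r x => [|y s IH] r x /=; first by rewrite cats0.
by rewrite IH cat_rcons.
Qed.

Lemma lex_lt_cons (l1 l2 : L) (s1 s2 : seq L) :
  lex_lt (l1 :: s1) (l2 :: s2) = (l1 <= l2) && ((l2 <= l1) ==> lex_lt s1 s2).
Proof. exact: ltxi_cons. Qed.

Lemma lex_ltn0 (s : seq L) : lex_lt s [::] = false.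
Proof. exact: ltxis0. Qed.

(* Clause (ii) of a quasi-chain, for all roots in a set R at once: the common
   label of a block does not depend on the root chosen below it, which is what
   survives when the first block is cut off. *)
Definition block_labeled (R : seq P -> Prop) x a : Prop :=
  forall i, (i < size a)%N -> exists l : L, forall r u v t, R r ->
    nth x (x :: a) i <= u -> cover u v -> v <= nth x (x :: a) i.+1 ->
    maxchain x u t -> {subset take i.+1 (x :: a) <= x :: t} ->
    lam (r ++ t) u v = l.

Lemma labels_const r x y s l :
  (forall u v t, x <= u -> cover u v -> v <= y -> maxchain x u t ->
     lam (r ++ t) u v = l) ->
  maxchain x y s -> labels lam r x s = nseq (size s) l.
Proof.
move=> H; elim/last_ind: s y H => [|s z IH] y H //.
rewrite -cats1 maxchain_cat maxchain_cons => /and3P[ms cz mzy].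
have zy := maxchain_le mzy.
rewrite labels_cat /= (IH (last x s)) //; last first.
  by move=> u v t xu cuv vs; apply: H => //; apply/(le_trans vs)/ltW/(lt_le_trans (cover_lt cz)).
rewrite (H _ _ s (maxchain_le ms) cz zy ms) size_cat.
by rewrite nseqD.
Qed.

Lemma block_labeled_head R x (a1 : P) a : block_labeled R x (a1 :: a) ->
  exists l, forall r s, R r -> maxchain x a1 s ->
    labels lam r x s = nseq (size s) l.
Proof.
move=> H; have [l Hl] := H 0 isT; exists l => r s Rr ms.
apply: labels_const ms => u v t xu cuv va mt; apply: Hl => //.
by move=> z; rewrite inE => /eqP ->; rewrite mem_head.
Qed.

Lemma block_labeled_tail R x (a1 : P) a : block_labeled R x (a1 :: a) ->
  block_labeled (fun r => exists r1 s1,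
     [/\ R r1, maxchain x a1 s1 & r = r1 ++ s1]) a1 a.
Proof.
move=> H i ia; have [l Hl] := H i.+1 ia; exists l => r u v t.
case=> r1 [s1 [Rr1 ms1 ->]] au cuv va mt sub.
rewrite -catA; apply: Hl => //.
- by move: au; rewrite /= (set_nth_default x) // ltnS ltnW.
- by move: va => /=; rewrite (set_nth_default x).
- by rewrite maxchain_cat (maxchain_last ms1) ms1.
move=> z; rewrite [take _ _]/= inE => /orP[/eqP ->|]; first exact: mem_head.
move=> /sub; rewrite inE -cat_cons mem_cat => /orP[/eqP ->|->]; last by rewrite orbT.
by rewrite maxchain_last_mem.
Qed.

(** A nonempty constant run affects ascent only through its label, so blocks of different lengths
    can be compared. *)
Lemma path_nseq_cat l0 l n (s : seq L) :
  path <=%O l0 (nseq n.+1 l ++ s) = (l0 <= l) && path <=%O l s.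
Proof. by elim: n l0 => //= n IH l0; rewrite IH lexx. Qed.

(** Each block is nonempty, as [a] increases strictly, and carries its common label, so ascent
    depends only on the sequence of block labels. There are two roots because the chains may differ
    below the current block; the preceding label [l0] carries the comparison across block
    borders. *)
Lemma path_labels_blocks R x a r r' s s' : block_labeled R x a ->
  path <%O x a -> R r -> R r' ->
  maxchain x (last x a) s -> maxchain x (last x a) s' ->
  {subset a <= x :: s} -> {subset a <= x :: s'} ->
  forall l0, path <=%O l0 (labels lam r x s) = path <=%O l0 (labels lam r' x s').
Proof.
elim: a R x r r' s s' => [|a1 a IH] R x r r' s s' H pa Rr Rr'.
  by move=> /maxchain_refl -> /maxchain_refl ->.
move=> ms ms' sub sub' l0; case/andP: pa => xa1 pa.
have [l Hl] := block_labeled_head H.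
have [s1 [s2 [es m1 m2]]] := maxchain_split ms (sub _ (mem_head _ _)).
have [s1' [s2' [es' m1' m2']]] := maxchain_split ms' (sub' _ (mem_head _ _)).
have xna : x != a1 by rewrite lt_eqF.
have tail t1 t2 t : maxchain x a1 t1 -> t = t1 ++ t2 ->
    {subset a1 :: a <= x :: t} -> {subset a <= a1 :: t2}.
  move=> mt et st z za; have zt := st z; rewrite inE za orbT in zt.
  have a1z : a1 < z by have := order_path_min lt_trans pa => /allP/(_ z za).
  move: (zt isT); rewrite et -cat_cons mem_cat [z \in a1 :: _]inE => /orP[zt1|->].
    by case/andP: (maxchain_mem_le mt zt1) => _ /(lt_le_trans a1z); rewrite ltxx.
  by rewrite orbT.
rewrite es es' !labels_cat (Hl _ _ Rr m1) (Hl _ _ Rr' m1').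
rewrite (maxchain_last m1) (maxchain_last m1').
case: s1 m1 es (maxchain_neq m1 xna) => [|y1 t1] m1 es // _.
case: s1' m1' es' (maxchain_neq m1' xna) => [|y1' t1'] m1' es' // _.
rewrite !path_nseq_cat; congr andb.
apply: IH (block_labeled_tail H) pa _ _ m2 m2' _ _ _.
- by exists r, (y1 :: t1).
- by exists r', (y1' :: t1').
- exact: tail m1 es sub.
- exact: tail m1' es' sub'.
Qed.

(** The converse of clause (i): the ascending chain [s0] contains [a], and ascent is shared by all
    maximal chains containing [a]. *)
Lemma quasi_chain_ascending r x y a s : quasi_chain lam r x y a ->
  maxchain x y s -> {subset x :: a <= x :: s} ->
  weakly_ascending (labels lam r x s).
Proof.
case=> -[pa la] [s0 ms0 as0] Hi Hii _ ms sub.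
have H : block_labeled (eq r) x a.
  by move=> i /Hii[l Hl]; exists l => _ u v t <-; apply: Hl.
have sub0 := Hi _ ms0 as0.
have suba t : {subset x :: a <= x :: t} -> {subset a <= x :: t}.
  by move=> st z za; apply: st; rewrite inE za orbT.
rewrite -la in ms ms0.
have E := path_labels_blocks H pa erefl erefl ms ms0 (suba _ sub) (suba _ sub0).
case: a {Hi Hii sub sub0 suba E} pa la ms ms0 H (E) => [|a1 a] pa la ms ms0 H E.
  by move: ms => /maxchain_refl ->.
have {}E l : path <=%O l (labels lam r x s0) -> sorted <=%O (labels lam r x s).
  by rewrite -E; apply: path_sorted.
case: s0 ms0 as0 E => [/maxchain_last /= e|y0 s0 ms0 as0 E]; last first.
  (* With its own first label as preceding label, a sorted sequence satisfies the path condition. *)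
  by apply: (E (lam r x y0)); rewrite /= lexx.
by case: s ms => // y1 s /[!e] /maxchain_refl.
Qed.

Hypothesis hlam : quasi_CL_labeling lam.

Lemma exists_ascending r x y : maxchain \bot x r -> x <= y ->
  exists2 s, maxchain x y s & weakly_ascending (labels lam r x s).
Proof. by move=> mr xy; have [a [_ ? _ _ _]] := hlam xy mr. Qed.

(** A chain that is not ascending misses [a], so clause (iii) applies. *)
Lemma ascending_lex_lt r x y s t : maxchain \bot x r ->
  maxchain x y s -> maxchain x y t ->
  weakly_ascending (labels lam r x s) -> ~~ weakly_ascending (labels lam r x t) ->
  lex_lt (labels lam r x s) (labels lam r x t).
Proof.
move=> mr ms mt as_ nt; have [a qa] := hlam (maxchain_le ms) mr.
have [_ _ Hi _ Hiii] := qa; apply: Hiii => //; first exact: Hi.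
by move=> sub; case/negP: nt; apply: quasi_chain_ascending qa mt sub.
Qed.

(* Otherwise z followed by an ascending chain would be lexicographically
   earlier than the ascending chain y :: s. *)
Lemma ascending_from_small_label r x v y s z t : maxchain \bot x r ->
  maxchain x v (y :: s) -> weakly_ascending (labels lam r x (y :: s)) ->
  maxchain x v (z :: t) -> lam r x z <= lam r x y ->
  exists2 t', maxchain x v (z :: t') &
    weakly_ascending (labels lam r x (z :: t')).
Proof.
move=> mr ms as_ mt le_zy; have := mt; rewrite maxchain_cons => /andP[cz mz].
have mrz : maxchain \bot z (rcons r z).
  by rewrite -cats1 maxchain_cat (maxchain_last mr) mr maxchain_cons cz /maxchain /=.
have [t' mt' at'] := exists_ascending mrz (maxchain_le mz).
have mzt' : maxchain x v (z :: t') by rewrite maxchain_cons cz.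
exists t' => //; apply/negPn/negP => nasc.
have := ascending_lex_lt mr ms mzt' as_ nasc.
rewrite /= lex_lt_cons le_zy /= => /andP[le_yz].
case: t' mt' at' mzt' nasc => [|w t'] mt' at' mzt' nasc; first by rewrite lex_ltn0.
have lt_wz : lam (rcons r z) z w < lam r x z.
  move: nasc at'; rewrite /weakly_ascending /= => nasc at'.
  by rewrite ltNge; apply: contra nasc => ->.
case: s ms as_ => [|y' s] ms as_.
  move: (ms); rewrite maxchain_cons => /andP[cy /maxchain_last /= ey].
  by rewrite ey in cy; have := maxchain_cover cy mzt'.
rewrite /= lex_lt_cons => /andP[le' _].
move: as_; rewrite /weakly_ascending /= => /andP[le'' _].
by have := lt_le_trans lt_wz (le_trans le_zy (le_trans le'' le')); rewrite ltxx.
Qed.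

End Labels.
End MaximalChains.

(** * Bypassing part of a chain by an earlier chain *)

Lemma first_common (T : eqType) (A s : seq T) : has (mem A) s ->
  exists s1 v s2, [/\ s = s1 ++ v :: s2, v \in A & {in s1, forall z, z \notin A}].
Proof.
elim: s => //= x s IH; case: (boolP (x \in A)) => [xA _|xA /= /IH].
  by exists [::], x, s.
case=> s1 [v [s2 [-> vA H]]]; exists (x :: s1), v, s2; split=> // z.
by rewrite inE => /orP[/eqP ->//|/H].
Qed.

Lemma path_lt_before (d : Order.disp_t) (T : porderType d) (x u b : T) s1 s2 :
  path <%O x (s1 ++ u :: s2) -> b \in s1 -> b < u.
Proof.
move=> + /splitPr b1; case: b1 => t1 t2; rewrite -catA cat_path /= => /and3P[_ _].
move/(order_path_min lt_trans)/allP; apply.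
by rewrite mem_cat mem_head orbT.
Qed.

Section SkippedIntervals.

Context {d d' : Order.disp_t} {P : finTBPOrderType d} {L : orderType d'}.
Variables (lam : seq P -> P -> P -> L) (ext : rel P).
Implicit Types (x y z u v w : P) (p q r s t c : seq P).

Lemma maxchain_lastI x v y s :
  maxchain x v (y :: s) -> rcons (belast y s) v = y :: s.
Proof. by move=> /maxchain_last /= <-; rewrite -lastI. Qed.

Definition edge_lt r x y z :=
  (lam r x y < lam r x z) || ((lam r x y == lam r x z) && ext y z).

Lemma chain_lt_cons r x y z s t : y != z ->
  chain_lt lam ext r x (y :: s) (z :: t) = edge_lt r x y z.
Proof. by move=> /negPf /= ->. Qed.

Lemma chain_lt_catl r x p s t :
  chain_lt lam ext r x (p ++ s) (p ++ t) =
    chain_lt lam ext (r ++ p) (last x p) s t.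
Proof.
elim: p r x => [|y p IH] r x /=; first by rewrite cats0.
by rewrite eqxx IH cat_rcons.
Qed.

(** [chain_lt] holds only after a divergence, and nothing beyond it is inspected; hence a local
    bypass makes the whole chain earlier. *)
Lemma chain_lt_catr r x s t s2 t2 : chain_lt lam ext r x s t ->
  chain_lt lam ext r x (s ++ s2) (t ++ t2).
Proof.
by elim: s r x t => [|y s IH] r x [|z t] //=; case: ifP => // _; apply: IH.
Qed.

Lemma chain_lt_diverge r x s t : chain_lt lam ext r x s t ->
  exists p y s' z t', [/\ s = p ++ y :: s', t = p ++ z :: t', y != z
    & edge_lt (r ++ p) (last x p) y z].
Proof.
elim: s r x t => [|y s IH] r x [|z t] //=; case: eqVneq => [<- | yz] H.
  have [p [y' [s' [z' [t' [-> -> n e]]]]]] := IH _ _ _ H.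
  by exists (y :: p), y', s', z', t'; split=> //=; rewrite -cat_rcons.
by exists [::], y, s, z, t; rewrite cats0.
Qed.

Lemma chain_lt_irr r x s : chain_lt lam ext r x s s = false.
Proof. by elim: s r x => //= y s IH r x; rewrite eqxx. Qed.

Lemma chain_lt_total x y s t r : total ext ->
  maxchain x y s -> maxchain x y t -> s != t ->
  chain_lt lam ext r x s t || chain_lt lam ext r x t s.
Proof.
move=> tot; elim: s t r x => [|u s IH] [|v t] r x //.
- by move=> /maxchain_last /= ->; move=> /maxchain_refl.
- by move=> + /maxchain_last /= e; rewrite e; move=> /maxchain_refl.
rewrite !maxchain_cons => /andP[_ ms] /andP[_ mt] /=.
case: (eqVneq u v) => [e|uv]; first by rewrite -e in mt *; rewrite eqseq_cons eqxx; apply: IH.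
by case: ltgtP => //= _ _; apply: tot.
Qed.

Section EdgeOrder.

Hypothesis hext : linear_extension ext.

Lemma edge_lt_trans r x u v w :
  edge_lt r x u v -> edge_lt r x v w -> edge_lt r x u w.
Proof.
have [_ _ tr _ _] := hext.
case/orP=> [uv|/andP[/eqP uv euv]] /orP[vw|/andP[/eqP vw evw]];
  apply/orP; rewrite ?uv -?vw ?uv ?eqxx; [left|left|left|right] => //=.
- exact: lt_trans vw.
- exact: tr evw.
Qed.

Lemma edge_lt_asym r x u v : u != v -> edge_lt r x u v -> ~~ edge_lt r x v u.
Proof.
have [_ anti _ _ _] := hext; rewrite /edge_lt eq_sym.
case: (ltgtP (lam r x u)) => //= _ uv euv; apply/negP => evu.
by move: uv; rewrite (anti u v) ?eqxx ?euv.
Qed.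

Lemma chain_lt_trans r x : transitive (chain_lt lam ext r x).
Proof.
move=> t s; elim: s r x t => [|u s IH] r x [|v t] [|w t'] //.
have [<-|uv] := eqVneq u v.
  have [<-|uw] := eqVneq u w; last by rewrite (chain_lt_cons _ _ _ _ uw) /= eqxx (negPf uw).
  by rewrite /= eqxx; apply: IH.
have [<-|vw] := eqVneq v w; first by rewrite !(chain_lt_cons _ _ _ _ uv).
rewrite (chain_lt_cons _ _ _ _ uv) (chain_lt_cons _ _ _ _ vw).
(* Equal outer heads would put [u] and [v] before each other. *)
have [e|uw] := eqVneq u w.
  by rewrite -e => /(edge_lt_asym uv)/negPf ->.
by rewrite (chain_lt_cons _ _ _ _ uw); apply: edge_lt_trans.
Qed.

End EdgeOrder.

Hypothesis hlam : quasi_CL_labeling lam.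

Definition descent r x y z := lam (rcons r y) y z < lam r x y.

Lemma exists_descent r x s : ~~ weakly_ascending (labels lam r x s) ->
  exists p u w s2, s = p ++ u :: w :: s2 /\ descent (r ++ p) (last x p) u w.
Proof.
rewrite /weakly_ascending; elim: s r x => [|y [|z s] IH] r x //.
rewrite /= negb_and -ltNge => /orP[lt|na].
  by exists [::], y, z, s; rewrite cats0.
have [p [u [w [s2 [-> D]]]]] := IH (rcons r y) y na.
by exists (y :: p), u, w, s2; rewrite -(cat_rcons y r).
Qed.

(** The ascending chain of the interval is lexicographically earlier, already at its first label:
    after a tie its second label would be at least the label before the descent, hence above the
    label after it. *)
Lemma descent_skipped r x u w : maxchain \bot x r -> cover x u -> cover u w ->
  descent r x u w -> exists2 q, maxchain x w (rcons q w) &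
    chain_lt lam ext r x (rcons q w) [:: u; w].
Proof.
move=> mr cxu cuw D; have xw := lt_trans (cover_lt cxu) (cover_lt cuw).
have [t mt at_] := exists_ascending hlam mr (ltW xw).
have muw : maxchain x w [:: u; w] by rewrite !maxchain_cons cxu cuw /maxchain /=.
have nuw : ~~ weakly_ascending (labels lam r x [:: u; w]).
  by rewrite /weakly_ascending /= andbT -ltNge.
have := ascending_lex_lt hlam mr mt muw at_ nuw.
case: t mt at_ => [|y t] mt at_ lex.
  by move: (maxchain_last mt) xw => /= ->; rewrite ltxx.
exists (belast y t); rewrite (maxchain_lastI mt) //.
have [e|yu] := eqVneq y u.
  move: mt at_; rewrite {}e maxchain_cons => /andP[_ /(maxchain_cover cuw) ->].
  by rewrite (negPf nuw).
rewrite chain_lt_cons // /edge_lt; move: lex.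
rewrite /= lex_lt_cons le_eqVlt; case: eqVneq => [e|_ /andP[/= ->//]].
rewrite e lexx /=; case: t mt at_ => [|z t] mt at_.
  move: mt; rewrite maxchain_cons => /andP[cy /maxchain_last /= ey]; rewrite ey in cy.
  by case: (cover_no_between cy (cover_lt cxu) (cover_lt cuw)).
move=> /=; rewrite lex_lt_cons => /andP[le' _].
move: at_; rewrite /weakly_ascending /= => /andP[]; rewrite e => le'' _.
by have := lt_le_trans D (le_trans le'' le'); rewrite ltxx.
Qed.

(** The inner elements [q] below [u] are replaced by [q']. A descent is bypassed alone. If there is
    none, [z] also starts an ascending chain; both chains pass through the first element of the
    quasi-chain above [x], and clause (ii) makes the labels up to there constant. *)
Lemma local_skip r x v y s z t : maxchain \bot x r ->
  maxchain x v (y :: s) -> maxchain x v (z :: t) -> z != y ->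
  edge_lt r x z y ->
  exists p q u s2 q', [/\ y :: s = p ++ rcons q u ++ s2,
    maxchain (last x p) u (rcons q' u),
    chain_lt lam ext (r ++ p) (last x p) (rcons q' u) (rcons q u)
  & (exists2 b, q = [:: b] & descent (r ++ p) (last x p) b u) \/
    (exists l, labels lam (r ++ p) (last x p) (rcons q u) = nseq (size q).+1 l)].
Proof.
move=> mr ms mt zy ezy.
have [as_|/exists_descent[p [u [w [s2 [es D]]]]]] :=
    boolP (weakly_ascending (labels lam r x (y :: s))); last first.
  move: ms; rewrite es maxchain_cat !maxchain_cons => /and4P[mp cu cw _].
  have mrp : maxchain \bot (last x p) (r ++ p).
    by rewrite maxchain_cat (maxchain_last mr) mr.
  have [q' mq' lq'] := descent_skipped mrp cu cw D.
  by exists p, [:: u], w, s2, q'; split=> //; left; exists u.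
have le_zy : lam r x z <= lam r x y.
  by case/orP: ezy => [/ltW //|/andP[/eqP -> _]].
have [t' mt' at'] := ascending_from_small_label hlam mr ms as_ mt le_zy.
have [a [[pa la] _ Hi Hii _]] := hlam (maxchain_le ms) mr.
have subs := Hi _ ms as_; have subt := Hi _ mt' at'.
case: a pa la Hii subs subt {Hi} => [|a1 a] /= pa la Hii subs subt.
  by move: ms; rewrite la => /maxchain_refl.
have a1in : a1 \in [:: x, a1 & a] by rewrite !inE eqxx orbT.
case/andP: pa => xa1 _.
have [s1 [s2 [es ms1 _]]] := maxchain_split ms (subs _ a1in).
have [t1 [t2 [et mt1 _]]] := maxchain_split mt' (subt _ a1in).
have xna : x != a1 by rewrite lt_eqF.
case: s1 ms1 es (maxchain_neq ms1 xna) => [|y1 s1] // ms1 [ey es] _.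
case: t1 mt1 et (maxchain_neq mt1 xna) => [|z1 t1] // mt1 [ez et] _.
subst y1 z1; exists [::], (belast y s1), a1, s2, (belast z t1).
rewrite cats0 (maxchain_lastI ms1) (maxchain_lastI mt1).
split=> //; first by rewrite es.
- by rewrite chain_lt_cons.
right; have [l Hl] := Hii 0 isT; exists l.
rewrite size_belast; apply: labels_const ms1 => u' v' t'' xu cuv va mt''.
apply: Hl => // z'; rewrite inE => /eqP ->; exact: mem_head.
Qed.

(** Let [w] be the last common element before the divergence and [v] the first later element of [c']
    on [c]. Strictly between them the chains share nothing, so [sigma], contained in both, has no
    element there. The new chain keeps all of [c] except [q]. *)
Lemma skipped_interval c c' (sigma : {set P}) :
  maxchain \bot \top c -> maxchain \bot \top c' ->
  chain_lt lam ext [::] \bot c' c ->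
  {subset sigma <= \bot :: c} -> {subset sigma <= \bot :: c'} ->
  exists p q u s q', [/\ c = p ++ rcons q u ++ s,
    {in q, forall b, b \notin sigma},
    maxchain \bot \top (p ++ rcons q' u ++ s) /\
      chain_lt lam ext [::] \bot (p ++ rcons q' u ++ s) c
  & (exists2 b, q = [:: b] & descent p (last \bot p) b u) \/
    (exists l, labels lam p (last \bot p) (rcons q u) = nseq (size q).+1 l)].
Proof.
move=> mc mc' /chain_lt_diverge[p [z [t [y [s [ec' ec zy /= ezy]]]]]] subc subc'.
rewrite {}ec {c} in mc subc *; rewrite {}ec' {c'} in mc' subc'.
move: (mc) (mc'); rewrite !maxchain_cat => /andP[mp ms] /andP[_ mt].
set w := last \bot p in mp ms mt ezy *.
have topmem x0 s0 : maxchain w \top (x0 :: s0) -> \top \in x0 :: s0.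
  by rewrite maxchain_cons => /andP[_ /maxchain_last_mem].
(* The chains meet again, at the latest in [\top]. *)
have /first_common[t1 [v [t2 [et vs nt1]]]] : has (mem (y :: s)) (z :: t).
  by apply/hasP; exists \top; [apply: topmem mt | apply: topmem ms].
have [s1 [s2 es]] : exists s1 s2, y :: s = s1 ++ v :: s2.
  by case/splitPr: vs => s1 s2; exists s1, s2.
have ms1 : maxchain w v (rcons s1 v) /\ maxchain v \top s2.
  by apply/andP; move: ms; rewrite es -cat_rcons maxchain_cat last_rcons.
have mt1 : maxchain w v (rcons t1 v).
  by move: mt; rewrite et -cat_rcons maxchain_cat last_rcons => /andP[].
case: ms1 => ms1 ms2.
have [s1' es1] : exists s1', rcons s1 v = y :: s1'.
  case: s1 es {ms1} => [[-> _]|y' s1 [<- _]]; first by exists [::].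
  by exists (rcons s1 v).
have [t1' et1] : exists t1', rcons t1 v = z :: t1'.
  case: t1 et {mt1 nt1} => [[-> _]|z' t1 [<- _]]; first by exists [::].
  by exists (rcons t1 v).
have ms1' : maxchain w v (y :: s1') by rewrite -es1.
have mt1' : maxchain w v (z :: t1') by rewrite -et1.
have [p1 [q [u [s3 [q' [e3 mq' lq' D]]]]]] := local_skip mp ms1' mt1' zy ezy.
have ec : p ++ y :: s = (p ++ p1) ++ rcons q u ++ (s3 ++ s2).
  by rewrite es -cat_rcons es1 e3 -!catA.
have lp : last \bot (p ++ p1) = last w p1 by rewrite last_cat.
exists (p ++ p1), q, u, (s3 ++ s2), q'; rewrite lp; split=> //.
- move=> b bq; apply/negP => bsig.
  have bv : b < v.
    have uv : u <= v.
      have u1 : u \in w :: rcons s1 v.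
        by rewrite es1 e3 inE !mem_cat mem_rcons mem_head !orbT.
      by case/andP: (maxchain_mem_le ms1 u1).
    apply: lt_le_trans uv; move: ms1; rewrite es1 e3 cat_rcons catA.
    by move/maxchain_path_lt/path_lt_before; apply; rewrite mem_cat bq orbT.
  have bys : b \in y :: s.
    by rewrite es -cat_rcons es1 e3 !mem_cat mem_rcons inE bq !orbT.
  have := subc' _ bsig; rewrite et -cat_cons mem_cat => /orP[bp|].
    have := maxchain_uniq mc; rewrite -cat_cons cat_uniq => /and3P[_ /hasPn H _].
    by have := H _ bys; rewrite bp.
  rewrite mem_cat => /orP[/nt1|bt2]; first by rewrite bys.
  have /maxchain_mem_le : maxchain v \top t2.
    by move: mt; rewrite et -cat_rcons maxchain_cat last_rcons => /andP[].
  by move=> /(_ b bt2)/andP[vb _]; have := lt_le_trans bv vb; rewrite ltxx.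
- rewrite ec; split; last first.
    by rewrite chain_lt_catl cat0s lp; apply: chain_lt_catr.
  move: mc; rewrite ec !maxchain_cat !last_cat !last_rcons.
  by case/andP=> /andP[-> ->] /and3P[_ -> ->]; rewrite mq'.
Qed.

End SkippedIntervals.

(** * Counting distinct and repeated labels *)

Lemma repeated_adjacent (d : Order.disp_t) (L : orderType d) (l0 a : L) l :
  weakly_descending l -> (2 <= count_mem a l)%N ->
  exists i, [/\ (i.+1 < size l)%N, nth l0 l i = a & nth l0 l i.+1 = a].
Proof.
elim: l => // x l IH dl; rewrite /= -/(weakly_descending _).
have [e /= c1|_ c2] := eqVneq x a; last first.
  by have [i [? ? ?]] := IH (path_sorted dl) c2; exists i.+1.
subst x; exists 0; case: l dl c1 {IH} => // y l /= /andP[yx pl] c1; split=> //.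
have : a \in y :: l by rewrite -has_pred1 has_count.
rewrite inE => /orP[/eqP //|al]; apply/le_anti.
have /allP/(_ _ al) ay := order_path_min (rev_trans le_trans) pl.
by rewrite yx.
Qed.

(** In the application, labels [i] and [i.+1] belong to the covers below and above element [i] of
    [c]. The indices of elements of [sigma] split into drops and plateaus: each label other than the
    first follows a drop, and each repeated label has a plateau of its own. *)
Lemma count_hit_blocks (d : Order.disp_t) (T : finType) (L : orderType d)
    (x0 : T) (l0 : L) (c : seq T) (l : seq L) (sigma : {set T}) :
  uniq c -> size l = size c ->
  (forall i, (i.+1 < size c)%N ->
     (nth l0 l i.+1 < nth l0 l i /\ nth x0 c i \in sigma) \/
     (nth l0 l i.+1 = nth l0 l i /\ exists j, [/\ (j.+1 < size c)%N,
        nth x0 c j \in sigma, nth l0 l j = nth l0 l i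
      & nth l0 l j.+1 = nth l0 l i])) ->
  weakly_descending l /\ (num_labels l + num_repeated l <= #|sigma|.+1)%N.
Proof.
move=> uc sl H; have dl : weakly_descending l.
  apply/(sortedP l0) => i; rewrite sl => /H[[/ltW //]|[-> _]]; exact: lexx.
split=> //; pose N := nth l0 l.
(* The last entry of [c] has no label above it and is left out. *)
pose idx := [seq j <- iota 0 (size c).-1 | nth x0 c j \in sigma].
have idxP j : (j \in idx) = (j.+1 < size c)%N && (nth x0 c j \in sigma).
  by rewrite mem_filter mem_iota andbC; congr andb; lia.
have size_idx : (size idx <= #|sigma|)%N.
  rewrite -(size_map (nth x0 c)) cardE; apply: uniq_leq_size.
    rewrite map_inj_in_uniq ?filter_uniq ?iota_uniq // => i j.
    rewrite !idxP => /andP[ic _] /andP[jc _] /eqP.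
    by rewrite nth_uniq ?(ltnW ic) ?(ltnW jc) // => /eqP.
  by move=> z /mapP[j]; rewrite idxP mem_enum => /andP[_ ?] ->.
have labels_le : (num_labels l <= (count (fun j => N j.+1 != N j) idx).+1)%N.
  rewrite -size_filter -(size_map (fun j => N j.+1)) -[_.+1]/(size (N 0 :: map _ _)).
  apply: uniq_leq_size; first exact: undup_uniq.
  move=> a; rewrite mem_undup => /(nthP l0)[i + <-]; rewrite sl -/(N i).
  elim: i => [|i IH] ic; first exact: mem_head.
  have [->|ne] := eqVneq (N i.+1) (N i); first exact/IH/ltnW.
  rewrite inE; apply/orP; right; apply: (map_f (fun j => N j.+1)).
  rewrite mem_filter ne idxP ic /=.
  by case: (H i ic) => [[]//|[/eqP]]; rewrite -/(N _) -/(N _) (negPf ne).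
have repeated_le : (num_repeated l <= count (fun j => N j.+1 == N j) idx)%N.
  rewrite -size_filter -(size_map N).
  apply: uniq_leq_size; first by rewrite filter_uniq ?undup_uniq.
  move=> a; rewrite mem_filter => /andP[/(repeated_adjacent l0 dl)].
  case=> i []; rewrite sl => ic ia ia' _.
  case: (H i ic) => [[]|[_ [j [jc js ja ja']]]]; first by rewrite ia ia' ltxx.
  rewrite -ia -ja -/(N j); apply: map_f.
  by rewrite mem_filter idxP jc js /N ja ja' eqxx.
have := count_predC (fun j => N j.+1 == N j) idx.
rewrite (eq_count (a1 := predC _) (a2 := fun j => N j.+1 != N j)) //.
lia.
Qed.

(** * Ordering the chains and matching faces by toggling *)

Fixpoint seqs_upto (T : finType) (n : nat) : seq (seq T) :=
  if n is m.+1 then [::] :: [seq x :: s | x <- enum T, s <- seqs_upto T m]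
  else [:: [::]].

Lemma mem_seqs_upto (T : finType) n (s : seq T) :
  (size s <= n)%N -> s \in seqs_upto T n.
Proof.
elim: n s => [|n IH] [|x s] //= sn; rewrite inE; apply/orP; right.
by apply: allpairs_f; rewrite ?mem_enum ?IH.
Qed.

Section Matching.

Context {d d' : Order.disp_t} {P : finTBPOrderType d} {L : orderType d'}.
Variables (lam : seq P -> P -> P -> L) (ext : rel P).
Hypothesis hext : linear_extension ext.
Implicit Types (b x y : P) (c : seq P) (sigma tau : {set P}).

Local Notation clt := (chain_lt lam ext [::] \bot).

Definition chain_le : rel (seq P) := [rel c c' | (c == c') || clt c c'].

(** Sequences over [P] form an infinite type; the bound [#|P|] on the length loses no maximal chain,
    as these have no repetitions. *)
Definition chains : seq (seq P) :=
  sort chain_le [seq c <- undup (seqs_upto P #|P|) | maxchain \bot \top c].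

Lemma mem_chains c : (c \in chains) = maxchain \bot \top c.
Proof.
rewrite mem_sort mem_filter mem_undup; apply: andb_idr => mc.
apply: mem_seqs_upto; have /andP[_ uc] := maxchain_uniq mc.
by rewrite -(card_uniqP uc) max_card.
Qed.

Lemma uniq_chains : uniq chains.
Proof. by rewrite sort_uniq filter_uniq // undup_uniq. Qed.

Lemma chains_lt i j : (i < j)%N -> (j < size chains)%N ->
  clt (nth [::] chains i) (nth [::] chains j).
Proof.
move=> ij js; have is_ := ltn_trans ij js.
have tr : transitive chain_le.
  move=> s t u; rewrite /chain_le /= => /orP[/eqP -> //|ts] /orP[/eqP <-|su].
    by rewrite ts orbT.
  by rewrite (chain_lt_trans hext ts su) orbT.
have srt : sorted chain_le chains.
  (* Totality of [chain_le] is only available among maximal chains. *)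
  apply: (@sort_sorted_in _ (maxchain \bot \top)); last exact: filter_all.
  move=> s t ms mt; rewrite /chain_le /= orbACA [t == s]eq_sym orbb.
  have [//|st /=] := eqVneq s t.
  by have [_ _ _ tot _] := hext; apply: chain_lt_total ms mt st.
have /orP[|//] := sorted_ltn_nth tr [::] srt i j is_ js ij.
by rewrite nth_uniq ?uniq_chains // => /eqP e; rewrite e ltnn in ij.
Qed.

Lemma index_chains_lt c c' : c \in chains -> c' \in chains -> clt c c' ->
  (index c chains < index c' chains)%N.
Proof.
move=> cin cin' lt; rewrite ltnNge; apply/negP; rewrite leq_eqVlt => /orP[/eqP e|].
  by move: lt; rewrite -(nth_index [::] cin) -e nth_index // chain_lt_irr.
move=> /chains_lt; rewrite index_mem => /(_ cin); rewrite !nth_index // => lt'.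
by have := chain_lt_trans hext lt lt'; rewrite chain_lt_irr.
Qed.

(** The value is [size chains] if no maximal chain contains [sigma]. The classes of the matching are
    the fibres of [rank]. *)
Definition rank sigma : nat :=
  find (fun c => sigma \subset \bot :: c) chains.

Lemma rank_mono sigma tau : sigma \subset tau -> (rank sigma <= rank tau)%N.
Proof. by move=> st; apply: sub_find => c; apply: subset_trans. Qed.

Lemma rank_le_index sigma c : c \in chains -> sigma \subset \bot :: c ->
  (rank sigma <= index c chains)%N.
Proof.
move=> cin sc; rewrite leqNgt; apply/negP => /(before_find [::]).
by rewrite nth_index // sc.
Qed.

Lemma rank_sub sigma : (rank sigma < size chains)%N ->
  sigma \subset \bot :: nth [::] chains (rank sigma).
Proof. by rewrite -has_find => /(nth_find [::]). Qed.

Lemma first_maxchain_rank sigma c : first_maxchain lam ext sigma c ->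
  c \in chains /\ rank sigma = index c chains.
Proof.
case=> mc /subsetP sc first; have cin : c \in chains by rewrite mem_chains.
split=> //; apply/eqP; rewrite eqn_leq rank_le_index //= leqNgt; apply/negP => lt.
have rs := ltn_trans lt (etrans (index_mem _ _) cin).
have c0in := mem_nth [::] rs.
have := first (nth [::] chains (rank sigma)).
rewrite -mem_chains c0in => /(_ isT) H.
have /index_chains_lt : clt c (nth [::] chains (rank sigma)).
  apply: H; first exact/subsetP/rank_sub.
  by move=> e; move: lt; rewrite -e index_uniq ?uniq_chains ?ltnn.
move=> /(_ cin c0in); rewrite index_uniq ?uniq_chains // => lt'.
by have := ltn_trans lt lt'; rewrite ltnn.
Qed.

(** The choice depends only on [k], so all faces of a class toggle the same element. Only removal is
    tested: as [b] lies on the chain of the class, its insertion never leaves the class. *)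
Definition toggle (k : nat) : option P :=
  [pick b | [&& b != \bot, b != \top, b \in nth [::] chains k &
    [forall sigma, is_face sigma && (rank sigma == k) ==>
       (rank (sigma :\ b) == k)]]].

Definition toggle_matching : {set {set P} * {set P}} :=
  [set p | is_face p.2 &&
    (if toggle (rank p.2) is Some b then (b \in p.2) && (p.1 == p.2 :\ b)
     else false)].

Lemma toggle_matchingP p : p \in toggle_matching -> exists b,
  [/\ toggle (rank p.2) = Some b, is_face p.2, b \in p.2, p.1 = p.2 :\ b
    & rank p.1 = rank p.2].
Proof.
rewrite inE => /andP[fp]; case e: (toggle _) => [b|//] /andP[bp /eqP ep].
exists b; split=> //; rewrite ep; move: e; rewrite /toggle; case: pickP => // b'.
by case/and4P=> _ _ _ /forallP/(_ p.2) + [<-]; rewrite fp eqxx => /eqP.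
Qed.

Lemma is_face_sub sigma tau : sigma \subset tau -> is_face tau -> is_face sigma.
Proof.
move=> /subsetP st /andP[/forall_inP t1 /forall_inP t2].
apply/andP; split; apply/forall_inP => x /st xt; first exact: t1.
by apply/forall_inP => y /st; move/forall_inP: (t2 x xt); apply.
Qed.

(** The faces of a pair have equal rank, hence the same [b], which lies in the upper one only. So no
    face is lower in one pair and upper in another, and either face determines the pair. *)
Lemma toggle_is_matching : is_matching toggle_matching.
Proof.
split=> [p|p q].
  case/toggle_matchingP => b [_ fp bp ep _]; rewrite /face_cover fp ep.
  by rewrite (is_face_sub (subsetDl _ _) fp) subsetDl (cardsD1 b p.2) bp /=.
case/toggle_matchingP => b [tp fp bp ep rp].
case/toggle_matchingP => b' [tq fq bq eq rq].
have same : rank p.2 = rank q.2 -> b = b'.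
  by move=> e; move: tp; rewrite e tq => -[].
have cross : p.1 = q.2 -> False.
  move=> e; have eb : b = b' by apply: same; rewrite -rp e.
  by move: bq; rewrite -e ep eb setD11.
have cross' : p.2 = q.1 -> False.
  move=> e; have eb : b = b' by apply: same; rewrite -rq e.
  by move: bp; rewrite e eq eb setD11.
case/or4P=> /eqP e.
- have eb : b = b' by apply: same; rewrite -rp -rq e.
  rewrite [p]surjective_pairing [q]surjective_pairing e.
  by rewrite -(setD1K bp) -(setD1K bq) -ep -eq e eb.
- by case: (cross e).
- by case: (cross' e).
- have eb : b = b' by apply: same; rewrite e.
  by rewrite [p]surjective_pairing [q]surjective_pairing ep eq e eb.
Qed.

(** This encodes a lexicographic order with [rank] first: the second summand is at most
    [2 * #|P| + 1], below the factor of [rank]. *)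
Definition potential sigma : nat :=
  (rank sigma * (2 * #|P| + 3) +
   (if toggle (rank sigma) is Some b then 2 * #|sigma :\ b| + (b \notin sigma)
    else 2 * #|sigma|))%N.

(** A reversed arrow inserts [b] and loses the term [b \notin sigma]. Any other arrow removes an
    element, so the rank cannot grow; at equal rank the removed element is not the toggled one, and
    the cardinality term drops. *)
Lemma potential_decr sigma tau :
  modified_hasse toggle_matching sigma tau ->
  (potential tau < potential sigma)%N.
Proof.
rewrite /modified_hasse /potential /= => /orP[/andP[]|]; last first.
  case/toggle_matchingP => b /= [tb _ bt -> ->].
  by rewrite tb setD11 bt setDDl setUid /= ltn_add2l ltn_add2l.
case/and4P=> ft fs sub /eqP card nM.
have := rank_mono sub; rewrite leq_eqVlt => /orP[/eqP e|lt].
  rewrite e ltn_add2l; case tb: (toggle _) => [b|]; last by rewrite card ltn_mul2l ltnSn.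
  have := cardsD1 b sigma; have := cardsD1 b tau; rewrite card.
  (* Removing [b] itself within the class would give a matched pair, whose arrow points up. *)
  have : (b \in tau) = (b \in sigma).
    apply/idP/idP => [/(subsetP sub)//|bs]; apply: contraR nM => bt.
    rewrite inE /= fs tb bs eqEcard subsetD1 sub bt /=.
    by rewrite -ltnS -card (cardsD1 b sigma) bs.
  by move=> ->; case: (b \in sigma) => /=; lia.
have bnd : (forall b, 2 * #|tau :\ b| + (b \notin tau) <= 2 * #|P| + 1)%N.
  move=> b; have : (#|tau :\ b| <= #|P|)%N by apply: max_card.
  by case: (b \notin tau) => /=; lia.
have bnd' : (#|tau| <= #|P|)%N by apply: max_card.
move: lt; set k := rank tau; set k' := rank sigma => lt.
have : ((k * (2 * #|P| + 3) + (2 * #|P| + 3)) <= k' * (2 * #|P| + 3))%N.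
  by rewrite addnC -mulSn leq_mul2r lt orbT.
move=> le; apply: leq_trans (leq_addr _ _); apply: leq_trans le.
rewrite -addnS leq_add2l; case: (toggle k) => [b|].
  by apply: leq_ltn_trans (bnd b) _; rewrite ltn_add2l.
by apply: leq_ltn_trans (leq_mul (leqnn 2) bnd') _; rewrite -{1}[(2 * _)%N]addn0 ltn_add2l.
Qed.

Lemma toggle_acyclic : acyclic_matching toggle_matching.
Proof.
split; first exact: toggle_is_matching.
case=> // x s /= /(sub_path potential_decr) H.
have tr : transitive [rel f g : {set P} | (potential g < potential f)%N].
  by move=> f g h /= fg hf; apply: ltn_trans fg.
have /allP/(_ x) := order_path_min tr H.
by rewrite mem_rcons mem_head => /(_ isT) /=; rewrite ltnn.
Qed.

(** A toggle of the class would match [sigma], by removal or insertion. So there is none, and a face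
    [tau] of the class, possibly other than [sigma], witnesses that [b] fails. *)
Lemma critical_no_toggle sigma c b : critical toggle_matching sigma ->
  first_maxchain lam ext sigma c -> b != \bot -> b != \top -> b \in c ->
  exists tau, [/\ is_face tau, rank tau = rank sigma
    & (rank (tau :\ b) < rank sigma)%N].
Proof.
move=> [fs ncrit] fm b0 b1 bc; have [cin rs] := first_maxchain_rank fm.
have [mc /subsetP sc _] := fm.
have nthc : nth [::] chains (rank sigma) = c by rewrite rs nth_index.
case tb: (toggle (rank sigma)) => [b'|].
  have [b's|b's] := boolP (b' \in sigma).
    have /ncrit[_ //] : (sigma :\ b', sigma) \in toggle_matching.
    by rewrite inE /= fs tb b's eqxx.
  move: (tb); rewrite /toggle; case: pickP => // b'' /and4P[t0 t1 tc _] [e].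
  rewrite {}e nthc in t0 t1 tc.
  have sub : b' |: sigma \subset \bot :: c.
    apply/subsetP => x; rewrite in_setU1 => /orP[/eqP ->|/(subsetP sc)//].
    by rewrite inE tc orbT.
  have fbs : is_face (b' |: sigma).
    case/andP: fs => /forall_inP s1 _; apply/andP; split.
      by apply/forall_inP => x; rewrite !inE => /orP[/eqP ->|/s1//]; rewrite t0.
    apply/forall_inP => x /(subsetP sub) xc; apply/forall_inP => y /(subsetP sub) yc.
    exact: maxchain_comparable mc xc yc.
  have rbs : rank (b' |: sigma) = rank sigma.
    by apply/eqP; rewrite eqn_leq {1}rs rank_le_index // rank_mono ?subsetUr.
  have /ncrit[] : (sigma, b' |: sigma) \in toggle_matching.
    by rewrite inE /= fbs rbs tb setU11 setU1K // eqxx.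
  by [].
move: tb; rewrite /toggle; case: pickP => // /(_ b).
rewrite b0 b1 nthc bc /= => /negbT; rewrite negb_forall => /existsP[tau].
rewrite negb_imply => /andP[/andP[ft /eqP rt] ne] _; exists tau; split=> //.
by rewrite ltn_neqAle ne -rt rank_mono // subsetDl.
Qed.

(** * Labels on the first chain of a critical face *)

Hypothesis hlam : quasi_CL_labeling lam.

(** An earlier chain contains [tau :\ b], which gives a bypass of some [q] that [tau :\ b] misses.
    Every face of the class meets [q], or else the bypassing chain would contain it. So [tau] meets
    [q], necessarily in [b], and [sigma] meets [q] too. *)
Lemma critical_skipped sigma c b : critical toggle_matching sigma ->
  first_maxchain lam ext sigma c -> b != \bot -> b != \top -> b \in c ->
  exists p q u s, [/\ c = p ++ rcons q u ++ s, b \in q,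
    exists2 x, x \in q & x \in sigma
  & (exists2 x, q = [:: x] & descent lam p (last \bot p) x u) \/
    (exists l, labels lam p (last \bot p) (rcons q u) = nseq (size q).+1 l)].
Proof.
move=> crit fm b0 b1 bc; have [cin rs] := first_maxchain_rank fm.
have [mc sc _] := fm.
have [tau [ft rt lt]] := critical_no_toggle crit fm b0 b1 bc.
have rsz : (rank sigma < size chains)%N by rewrite rs index_mem.
have jsz := ltn_trans lt rsz.
have nthc : nth [::] chains (rank sigma) = c by rewrite rs nth_index.
have tc : tau \subset \bot :: c by rewrite -nthc -rt rank_sub ?rt.
have mc' : maxchain \bot \top (nth [::] chains (rank (tau :\ b))).
  by rewrite -mem_chains mem_nth.
have ltc := chains_lt lt rsz; rewrite nthc in ltc.
have sub1 : {subset tau :\ b <= \bot :: c}.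
  by apply/subsetP; apply: subset_trans tc; apply: subsetDl.
have /subsetP sub2 := rank_sub jsz.
have [p [q [u [s [q' [ec nq [mc'' ltc''] D]]]]]] :=
  skipped_interval hlam mc mc' ltc sub1 sub2.
have hit (rho : {set P}) : rho \subset \bot :: c -> rank rho = rank sigma ->
    exists2 x, x \in q & x \in rho.
  move=> rc rr; apply/hasP/negPn/negP => /hasPn no.
  have := index_chains_lt _ cin ltc''; rewrite mem_chains => /(_ mc'').
  rewrite -rs -rr ltnNge rank_le_index ?mem_chains //.
  apply/subsetP => x xr; move: (subsetP rc x xr); rewrite ec !inE !mem_cat !mem_rcons !inE.
  case/or3P=> [->//|->|/orP[/orP[->|xq]|->]]; rewrite ?orbT //.
  by move: (no x xq); rewrite /= xr.
exists p, q, u, s; split=> //; last by apply: hit => //; apply/subsetP.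
have [x xq xt] := hit tau tc rt.
by move: (nq x xq); rewrite !inE xt andbT negbK => /eqP <-.
Qed.

(** At a bypassed descent, [q] has a single element, which is then both [b] and the member of
    [sigma]. In a constant block the member of [sigma] may be another element of [q], with the same
    label on both sides. *)
Lemma critical_labels sigma c (l0 : L) : critical toggle_matching sigma ->
  first_maxchain lam ext sigma c ->
  let l := labels lam [::] \bot c in
  forall i, (i.+1 < size c)%N ->
    (nth l0 l i.+1 < nth l0 l i /\ nth \bot c i \in sigma) \/
    (nth l0 l i.+1 = nth l0 l i /\ exists j, [/\ (j.+1 < size c)%N,
       nth \bot c j \in sigma, nth l0 l j = nth l0 l i
     & nth l0 l j.+1 = nth l0 l i]).
Proof.
move=> crit fm l i ic; have [mc _ _] := fm; have ic' := ltnW ic.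
have nbot : \bot \notin c by case/andP: (maxchain_uniq mc).
have uc : uniq c by case/andP: (maxchain_uniq mc).
have bc : nth \bot c i \in c by rewrite mem_nth.
have b0 : nth \bot c i != \bot by apply: contraNneq nbot => <-.
have b1 : nth \bot c i != \top.
  have <- := maxchain_last mc; rewrite (last_nth \bot).
  case sz: (size c) (ic) => [//|n] ic1 /=.
  by rewrite nth_uniq ?sz ?(ltnW ic1) // ltn_eqF.
have [p [q [u [s [ec bq [x xq xs] D]]]]] := critical_skipped crit fm b0 b1 bc.
have nthc m : (m < size q)%N -> nth \bot c (size p + m) = nth \bot q m.
  move=> mq; rewrite ec nth_cat ltnNge leq_addr /= addKn nth_cat size_rcons.
  by rewrite ltnS (ltnW mq) nth_rcons mq.
have nthl m : (m <= size q)%N -> nth l0 l (size p + m) =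
    nth l0 (labels lam p (last \bot p) (rcons q u)) m.
  move=> mq; rewrite /l ec !labels_cat nth_cat size_labels ltnNge leq_addr /= addKn.
  by rewrite nth_cat size_labels size_rcons ltnS mq.
have szc : (size p + size q < size c)%N.
  by rewrite ec !size_cat size_rcons; lia.
have pos y : y \in q -> exists2 m, (m < size q)%N & nth \bot c (size p + m) = y.
  by move=> yq; exists (index y q); rewrite ?nthc ?index_mem ?nth_index.
have [m mq em] := pos _ bq.
have pmc k : (k <= size q)%N -> (size p + k < size c)%N.
  by move=> kq; apply: leq_ltn_trans szc; rewrite leq_add2l.
have ei : i = (size p + m)%N.
  by apply/eqP; rewrite -(nth_uniq \bot ic' (pmc _ (ltnW mq)) uc) em.
case: D => [[y eq D]|[a labc]]; [left|right].
  have [em0 exy] : m = 0 /\ x = y.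
    by move: mq xq; rewrite eq /= inE ltnS leqn0 => /eqP ? /eqP.
  rewrite ei em0 -addnS !nthl ?eq // nthc ?eq //= -exy; split=> //.
  by rewrite exy.
have cst k : (k <= size q)%N -> nth l0 l (size p + k) = a.
  by move=> kq; rewrite nthl // labc nth_nseq ltnS kq.
have [m' mq' em'] := pos _ xq.
rewrite ei -!addnS !cst ?(ltnW mq) //; split=> //; exists (size p + m')%N.
by rewrite -addnS em' !cst ?(ltnW mq') //; split=> //; apply: pmc.
Qed.

End Matching.

Theorem theorem5p3 (d d' : Order.disp_t) (P : finTBPOrderType d)
    (L : orderType d') (lam : seq P -> P -> P -> L) (ext : rel P)
    (hlam : quasi_CL_labeling lam) (hext : linear_extension ext) :
  exists M : {set {set P} * {set P}},
    acyclic_matching M /\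
    forall sigma : {set P}, critical M sigma ->
    forall c : seq P, first_maxchain lam ext sigma c ->
      let l := labels lam [::] (Order.bottom : P) c in
      weakly_descending l /\
      ((num_labels l + num_repeated l)%N%:Z - 2 <= face_dim sigma)%R.
Proof.
exists (toggle_matching lam ext); split; first exact: toggle_acyclic.
move=> sigma crit c fm l; have [mc _ _] := fm.
have /andP[_ uc] := maxchain_uniq mc.
pose l0 := lam [::] \bot \bot.
have [dl cnt] := count_hit_blocks uc (size_labels _ _ _ _)
  (critical_labels hext hlam l0 crit fm).
(* The count is bounded by [#|sigma|.+1], which is [face_dim sigma + 2]. *)
by split=> //; rewrite /face_dim; move: cnt; rewrite -/l; lia.
Qed.
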